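(* Let $n,d\ge 1$ be integers. Every $((n,2,d))$ CWS code is additive (i.e. it is a stabilizer code).
   Context: All codes are subspaces of the $n$-qubit Hilbert space $(\mathbb{C}^2)^{\otimes n}$. The $n$-qubit Pauli group consists of the operators $\alpha\,e_1\otimes\cdots\otimes e_n$ with $\alpha\in\{\pm1,\pm i\}$ and $e_i\in\{I,X,Y,Z\}$; the weight of such an operator is the number of indices $i$ with $e_i\ne I$. CWS (codeword stabilized) code: let $S$ be an abelian subgroup of the $n$-qubit Pauli group with $|S|=2^n$ and $-I\notin S$, and let $|S\rangle$ be the (unique up to phase) unit vector with $s|S\rangle=|S\rangle$ for all $s\in S$ (a stabilizer state). Let $w_1,\dots,w_K$ be $n$-qubit Pauli operators (word operators) such that $w_1|S\rangle,\dots,w_K|S\rangle$ are mutually orthogonal. The CWS code is the $K$-dimensional span of $w_1|S\rangle,\dots,w_K|S\rangle$. (Up to local Clifford operations one may put a CWS code in standard form, where $|S\rangle$ is a graph state and $w_i=Z^{\mathbf{c}_i}$ with $\mathbf{c}_1=0$.) $((n,K,d))$ code: a $K$-dimensional subspace of $(\mathbb{C}^2)^{\otimes n}$, with orthogonal projector $P$, that detects all Pauli errors of weight less than $d$, i.e. for every Pauli operator $E$ of weight $<d$ there is a scalar $\lambda_E$ with $PEP=\lambda_E P$. Additive code (= stabilizer code): a nonzero subspace that is the joint $+1$ eigenspace of an abelian subgroup of the $n$-qubit Pauli group not containing $-I$. *)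

(* Defs.v *)
From HB Require Import structures.
From mathcomp Require Import all_boot all_order all_algebra.
From mathcomp Require Import finmap.

Set Implicit Arguments.
Unset Strict Implicit.
Unset Printing Implicit Defensive.

Import Order.TTheory GRing.Theory Num.Theory.
Local Open Scope ring_scope.

Section QubitCodes.

Variables (C : numClosedFieldType) (n : nat).

(* A vector of (C^2)^{(x) n} is given by its coordinates in the computational
   basis, whose labels are the bit strings of length n. *)
Definition label := {ffun 'I_n -> 'I_2}.
Definition qubits := {ffun label -> C^o}.

Definition inner (u v : qubits) : C := \sum_(x : label) (u x)^* * v x.

(* The matrix of e_1 (x) ... (x) e_n in the computational basis has entry
   \prod_i e_i (x_i) (y_i) at row x and column y. *)
Definition tensor_fun (e : 'I_n -> 'M[C]_2) (v : qubits) : qubits :=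
  [ffun x : label => \sum_(y : label) (\prod_i e i (x i) (y i)) * v y].

Definition tensor_op (e : 'I_n -> 'M[C]_2) : 'End(qubits) :=
  linfun (tensor_fun e).

Lemma tensor_fun_linear e : linear (tensor_fun e).
Proof.
move=> a u v; apply/ffunP => x; rewrite !ffunE scaler_sumr -big_split /=.
by apply: eq_bigr => y _; rewrite !ffunE mulrDr /GRing.scale /= mulrCA.
Qed.

Lemma tensor_opE e v : tensor_op e v = tensor_fun e v.
Proof.
pose L := GRing.isLinear.Build _ _ _ _ (tensor_fun e) (tensor_fun_linear e).
pose f : {linear qubits -> qubits} := HB.pack (tensor_fun e) L.
exact: (lfunE f).
Qed.

Definition pauliX : 'M[C]_2 := \matrix_(a, b) (a != b)%:R.
Definition pauliY : 'M[C]_2 :=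
  \matrix_(a, b) if a == b then 0 else if a == 0 then - 'i else 'i.
Definition pauliZ : 'M[C]_2 :=
  \matrix_(a, b) if a == b then (-1) ^+ a else 0.

Definition pauli_mxs : seq 'M[C]_2 := [:: 1%:M; pauliX; pauliY; pauliZ].
Definition phases : seq C := [:: 1; -1; 'i; - 'i].

Definition pauli_form (alpha : C) (e : 'I_n -> 'M[C]_2) (E : 'End(qubits)) :=
  [/\ alpha \in phases, forall i, e i \in pauli_mxs
    & E = alpha *: tensor_op e].

Definition is_pauli (E : 'End(qubits)) := exists alpha e, pauli_form alpha e E.

Definition weight (e : 'I_n -> 'M[C]_2) : nat := #|[set i | e i != 1%:M]|.

(* Abelian subgroups of the Pauli group not containing -I. The Pauli group is
   finite, so taking S to be a finite set is no restriction; its elements are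
   invertible, so that s^-1 is their two-sided inverse. *)
Definition stabilizer_group (S : {fset 'End(qubits)}) : Prop :=
  [/\ forall s, s \in S -> is_pauli s,
      [/\ \1%VF \in S,
          forall s t, s \in S -> t \in S -> (s \o t)%VF \in S
        & forall s, s \in S -> (s^-1)%VF \in S],
      forall s t, s \in S -> t \in S -> (s \o t)%VF = (t \o s)%VF
    & - \1%VF \notin S].

Definition additive_code (Q : {vspace qubits}) : Prop :=
  Q != 0%VS /\
  exists2 S, stabilizer_group S &
    forall v, v \in Q <-> (forall s, s \in S -> s v = v).

Definition stabilizer_state (S : {fset 'End(qubits)}) (psi : qubits) : Prop :=
  [/\ stabilizer_group S, #|` S|%fset = (2 ^ n)%N, inner psi psi = 1
    & forall s, s \in S -> s psi = psi].

Definition cws_code (Q : {vspace qubits}) : Prop :=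
  exists (S : {fset 'End(qubits)}) (psi : qubits)
         (K : nat) (w : 'I_K -> 'End(qubits)),
    [/\ stabilizer_state S psi,
        forall i, is_pauli (w i),
        forall i j, i != j -> inner (w i psi) (w j psi) = 0
      & Q = <<[seq w i psi | i <- enum 'I_K]>>%VS].

Definition orth_projector (P : 'End(qubits)) (Q : {vspace qubits}) : Prop :=
  [/\ (P \o P)%VF = P, forall u v, inner (P u) v = inner u (P v)
    & limg P = Q].

Definition nKd_code (K d : nat) (Q : {vspace qubits}) : Prop :=
  \dim Q = K /\
  exists2 P, orth_projector P Q &
    forall alpha e E, pauli_form alpha e E -> (weight e < d)%N ->
      exists lambda : C, (P \o E \o P)%VF = lambda *: P.

End QubitCodes.

(* Main.v *)
(* The average of a stabilizer group of order 2^n is idempotent and, since the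
   only scalar in the group is 1 and every other Pauli operator is traceless,
   it has trace 1: the common fixed space is a line.  Conjugating by a Pauli
   word w, the vectors having the eigenvalues of w|S> under S form the line of
   w|S>.  For two words, the elements s or -s (s in S) that fix both
   w_0|S> and w_1|S> form a stabilizer group; some t in S separates the two
   words, and its eigenprojections split any vector fixed by this group into a
   component along each word. *)
Require Import Defs.
From mathcomp Require Import all_boot all_order all_algebra.
From mathcomp Require Import complex reals.
From mathcomp Require Import finmap.

Set Implicit Arguments.
Unset Strict Implicit.
Unset Printing Implicit Defensive.

Import Order.TTheory GRing.Theory Num.Theory.

Local Open Scope ring_scope.
Local Open Scope complex_scope.

(** * Traces of operators; idempotents of trace one *)

Section Trace.

(** Idempotence makes the two factors of the rank factorization, multiplied in the reverse order, an
    identity matrix of size [\rank A]; cyclicity of the trace concludes. *)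
Lemma mxtrace_idem (F : fieldType) (m : nat) (A : 'M[F]_m) :
  A *m A = A -> \tr A = (\rank A)%:R.
Proof.
move=> AA; have RC : row_base A *m col_base A = 1%:M.
  apply: (row_full_inj (col_base_full A)); rewrite mulmx1.
  apply: (row_free_inj (row_base_free A)).
  by rewrite mulmxA mulmx_base -mulmxA mulmx_base.
by rewrite -{1}(mulmx_base A) mxtrace_mulC RC mxtrace1.
Qed.

Variables (C : numClosedFieldType) (n : nat).
Local Notation qubits := (qubits C n).
Local Notation label := (label n).
Implicit Types (f g : 'End(qubits)) (v : qubits).

Definition ket (y : label) : qubits := [ffun x => (x == y)%:R].

Lemma qubits_expand v : v = \sum_y v y *: ket y.
Proof.
apply/ffunP => x; rewrite sum_ffunE (bigD1 x) //= big1 => [|y nyx].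
  by rewrite !ffunE eqxx addr0 /GRing.scale /= mulr1.
by rewrite !ffunE eq_sym (negPf nyx) scaler0.
Qed.

(** The rows are the images of the kets, so that the matrix acts on row vectors from the right and
    composition is reversed. *)
Definition lmat f : 'M[C]_#|label| :=
  \matrix_(i, j) f (ket (enum_val i)) (enum_val j).

Definition coords v : 'rV[C]_#|label| := \row_j v (enum_val j).

Lemma coords_inj : injective coords.
Proof.
move=> u v /rowP uv; apply/ffunP => x.
by have := uv (enum_rank x); rewrite !mxE enum_rankK.
Qed.

Lemma coordsZ a v : coords (a *: v) = a *: coords v.
Proof. by apply/rowP => j; rewrite !mxE !ffunE. Qed.

Lemma coords_lmat f v : coords (f v) = coords v *m lmat f.
Proof.
apply/rowP => j; rewrite !mxE {1}[v]qubits_expand linear_sum sum_ffunE.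
rewrite (reindex_onto enum_val enum_rank) => [|x _]; last by rewrite enum_rankK.
rewrite (eq_bigl xpredT) => [|i]; last by rewrite enum_valK eqxx.
by apply: eq_bigr => i _; rewrite linearZ !ffunE !mxE.
Qed.

Lemma lmat_comp f g : lmat (f \o g)%VF = lmat g *m lmat f.
Proof.
apply/row_matrixP => i; rewrite row_mul.
have rowE h : row i (lmat h) = coords (h (ket (enum_val i))).
  by apply/rowP => j; rewrite !mxE.
by rewrite !rowE -coords_lmat comp_lfunE.
Qed.

Definition ltrace f : C := \sum_y f (ket y) y.

Lemma mxtrace_lmat f : \tr (lmat f) = ltrace f.
Proof.
rewrite /mxtrace /ltrace [RHS](reindex_onto enum_val enum_rank) => [|x _].
  rewrite [RHS](eq_bigl xpredT) => [|i]; last by rewrite enum_valK eqxx.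
  by apply: eq_bigr => i _; rewrite mxE.
by rewrite enum_rankK.
Qed.

Lemma ltrace_sum (I : Type) (r : seq I) (F : I -> 'End(qubits)) :
  ltrace (\sum_(i <- r) F i) = \sum_(i <- r) ltrace (F i).
Proof.
rewrite /ltrace exchange_big /=; apply: eq_bigr => y _.
by rewrite sum_lfunE sum_ffunE.
Qed.

Lemma ltraceZ a f : ltrace (a *: f) = a * ltrace f.
Proof.
by rewrite /ltrace mulr_sumr; apply: eq_bigr => y _; rewrite scale_lfunE ffunE.
Qed.

Lemma ltrace1 : ltrace \1%VF = (2 ^ n)%:R.
Proof.
rewrite /ltrace (eq_bigr (fun=> 1)) => [|y _]; last first.
  by rewrite id_lfunE ffunE eqxx.
by rewrite sumr_const card_ffun !card_ord.
Qed.

Lemma ltrace_tensor e : ltrace (tensor_op e) = \prod_i \tr (e i).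
Proof.
rewrite /mxtrace bigA_distr_bigA; apply: eq_bigr => y _ /=.
rewrite tensor_opE ffunE (bigD1 y) //= ffunE eqxx mulr1 addrC.
rewrite big1 ?add0r // => x nxy.
by rewrite ffunE (negPf nxy) mulr0.
Qed.

(** In characteristic zero an idempotent of trace 1 has rank 1. Its fixed vectors lie in its row
    space, a line that the nonzero [u] already spans. *)
Lemma idem_trace1_line f u v :
  (f \o f)%VF = f -> ltrace f = 1 -> f u = u -> f v = v -> u != 0 ->
  v \in <[u]>%VS.
Proof.
move=> ff trf fu fv u0.
have rkf : \rank (lmat f) = 1%N.
  have := @mxtrace_idem _ _ (lmat f); rewrite -lmat_comp ff mxtrace_lmat trf.
  by move=> /(_ erefl)/eqP; rewrite eq_sym pnatr_eq1 => /eqP.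
have sub w : f w = w -> (coords w <= lmat f)%MS.
  by move=> fw; rewrite -fw coords_lmat submxMl.
have cu0 : coords u != 0.
  apply: contraNneq u0 => cu; apply/eqP/coords_inj; rewrite cu.
  by apply/rowP => j; rewrite !mxE ffunE.
have fsub : (lmat f <= coords u)%MS.
  by rewrite -(geq_leqif (mxrank_leqif_sup (sub u fu))) rkf rank_rV cu0.
have /sub_rVP[k vk] := submx_trans (sub v fv) fsub.
by apply/vlineP; exists k; apply: coords_inj; rewrite coordsZ.
Qed.

End Trace.
Arguments ltrace {C n}.

(** * Pauli operators and the fixed line of a full stabilizer group *)

Section Pauli.

Variables (C : numClosedFieldType) (n : nat).
Local Notation qubits := (qubits C n).
Implicit Types (s t w : 'End(qubits)) (u v psi : qubits).
Implicit Types (e : 'I_n -> 'M[C]_2).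

Lemma tensor_comp e e' :
  (tensor_op e \o tensor_op e')%VF = tensor_op (fun i => e i *m e' i).
Proof.
apply/lfunP => v; rewrite comp_lfunE !tensor_opE; apply/ffunP => x.
rewrite !ffunE.
under eq_bigr => y _ do rewrite ffunE mulr_sumr.
rewrite exchange_big /=; apply: eq_bigr => z _.
under eq_bigr => y _ do rewrite mulrA -big_split /=.
rewrite -mulr_suml; congr (_ * _).
(* The sum over intermediate labels factors into a product of sums over the bit of one qubit. *)
rewrite -(bigA_distr_bigA (fun i j => e i (x i) j * e' i j (z i))) /=.
by apply: eq_bigr => i _; rewrite mxE.
Qed.

Lemma eq_tensor e e' : e =1 e' -> tensor_op e = tensor_op e'.
Proof.
move=> ee; apply/lfunP => v; rewrite !tensor_opE; apply/ffunP => x.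
rewrite !ffunE; apply: eq_bigr => y _; congr (_ * _).
by apply: eq_bigr => i _; rewrite ee.
Qed.

Lemma tensorZ (a : 'I_n -> C) e :
  tensor_op (fun i => a i *: e i) = (\prod_i a i) *: tensor_op e.
Proof.
apply/lfunP => v; rewrite scale_lfunE !tensor_opE; apply/ffunP => x.
rewrite !ffunE /GRing.scale /= mulr_sumr; apply: eq_bigr => y _.
rewrite mulrA -big_split /=; congr (_ * _).
by apply: eq_bigr => i _; rewrite mxE.
Qed.

Lemma tensor1 : tensor_op (fun _ : 'I_n => 1%:M) = \1%VF :> 'End(qubits).
Proof.
apply/lfunP => v; rewrite id_lfunE tensor_opE; apply/ffunP => x.
rewrite ffunE (bigD1 x) //= [X in X * _]big1 => [|i _]; last by rewrite mxE eqxx.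
rewrite mul1r big1 ?addr0 // => y nyx.
have /existsP[i nxy] : [exists i, x i != y i].
  rewrite -negb_forall; apply: contra nyx => /forallP xy.
  by apply/eqP/ffunP => i; apply/esym/eqP.
by rewrite (bigD1 i) //= mxE (negPf nxy) !mul0r.
Qed.

Local Ltac mx2_entries :=
  apply/matrixP => -[[|[|[]]]] //= ? -[[|[|[]]]] //= ?;
  rewrite !mxE !big_ord_recl !big_ord0 !mxE /= ?expr0 ?expr1
    ?(mulr0, mul0r, addr0, add0r, mulr1, mul1r, mulrN, mulNr, opprK, oppr0).

Lemma pauli_mx_comm (a b : 'M[C]_2) : a \in pauli_mxs C -> b \in pauli_mxs C ->
  exists2 c : C, (c == 1) || (c == -1) & a *m b = c *: (b *m a).
Proof.
rewrite !inE => /or4P[] /eqP-> /or4P[] /eqP->;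
  (* The sign 1 is tried on each of the sixteen pairs; where it fails, the matrices anticommute. *)
  first [ exists 1; [by rewrite eqxx | mx2_entries; reflexivity]
        | exists (-1); [by rewrite eqxx orbT | mx2_entries; reflexivity] ].
Qed.

Lemma pauli_mx_sqr (a : 'M[C]_2) : a \in pauli_mxs C -> a *m a = 1%:M.
Proof.
by rewrite !inE => /or4P[] /eqP->; mx2_entries; rewrite // -expr2 sqrCi opprK.
Qed.

Lemma pauli_mx_trace (a : 'M[C]_2) :
  a \in pauli_mxs C -> a != 1%:M -> \tr a = 0.
Proof.
rewrite !inE => /or4P[] /eqP->; first by rewrite eqxx.
all: by move=> _; rewrite /mxtrace !big_ord_recl big_ord0 !mxE /= ?expr0 ?expr1
  ?addr0 ?subrr.
Qed.

Lemma phase_sqr (alpha : C) :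
  alpha \in phases C -> (alpha ^+ 2 == 1) || (alpha ^+ 2 == -1).
Proof.
by rewrite !inE => /or4P[] /eqP->; rewrite ?sqrrN ?sqrCi ?expr1n ?eqxx ?orbT.
Qed.

(** The commutation signs of the single qubits multiply to one global sign, and the phases agree on
    both sides. *)
Lemma pauli_comm s w : is_pauli s -> is_pauli w ->
  exists2 c : C, (c == 1) || (c == -1) & (s \o w)%VF = c *: (w \o s)%VF.
Proof.
move=> [a [e [_ he ->]]] [b [e' [_ he' ->]]].
have [c c1 cE] := fin_all_exists2 (fun i => pauli_mx_comm (he i) (he' i)).
exists (\prod_i c i).
  elim/big_rec: _ => [|i x _]; first by rewrite eqxx.
  case/orP=> /eqP->; have /orP[] := c1 i => /eqP->;
    by rewrite ?(mulrNN, mulr1, mul1r) eqxx ?orbT.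
rewrite -!comp_lfunZl -!comp_lfunZr !tensor_comp (eq_tensor cE).
rewrite tensorZ !scalerA; congr (_ *: _).
by rewrite [LHS]mulrC [a * b]mulrC mulrA.
Qed.

Lemma pauli_sqr s : is_pauli s ->
  exists2 c : C, (c == 1) || (c == -1) & (s \o s)%VF = c *: \1%VF.
Proof.
move=> [a [e [ha he ->]]]; exists (a ^+ 2); first exact: phase_sqr.
rewrite -!comp_lfunZl -!comp_lfunZr tensor_comp scalerA -expr2 -tensor1.
by congr (_ *: _); apply: eq_tensor => i; exact: pauli_mx_sqr.
Qed.

Lemma pauliN s : is_pauli s -> is_pauli (- s).
Proof.
move=> [a [e [ha he ->]]]; exists (- a), e; split=> //; last by rewrite scaleNr.
by move: ha; rewrite !inE => /or4P[] /eqP->; rewrite ?opprK eqxx ?orbT.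
Qed.

(** The trace is multiplicative over tensor factors, so a single traceless factor [X], [Y] or [Z]
    makes it vanish. *)
Lemma pauli_trace s : is_pauli s -> ltrace s != 0 ->
  exists alpha, s = alpha *: \1%VF.
Proof.
move=> [a [e [_ he ->]]]; rewrite ltraceZ ltrace_tensor => tr0; exists a.
rewrite -tensor1; congr (_ *: _); apply: eq_tensor => i; apply/eqP.
apply: contraNT tr0 => ei; rewrite (bigD1 i) //=.
by rewrite pauli_mx_trace // mul0r mulr0.
Qed.

Variable S : {fset 'End(qubits)}.
Hypothesis stabS : stabilizer_group S.

(** The square of a Pauli operator is plus or minus the identity, and closure together with the
    exclusion of [- \1] rules out the minus sign. *)
Lemma stabilizer_sqr s : s \in S -> (s \o s)%VF = \1%VF.
Proof.
case: stabS => pS [_ cS _] _ nN sS.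
have [c /orP[]/eqP-> e] := pauli_sqr (pS _ sS); first by rewrite e scale1r.
by move: (cS _ _ sS sS); rewrite e scaleN1r (negPf nN).
Qed.

Lemma stabilizer_trace s : s \in S -> s != \1%VF -> ltrace s = 0.
Proof.
case: stabS => pS _ _ nN sS; apply: contraNeq => /(pauli_trace (pS _ sS))[a sE].
have tr1 : ltrace (\1%VF : 'End(qubits)) != 0.
  by rewrite ltrace1 pnatr_eq0 expn_eq0.
have := congr1 ltrace (stabilizer_sqr sS).
rewrite sE -comp_lfunZl -comp_lfunZr comp_lfun1l scalerA -expr2 ltraceZ.
rewrite -[RHS]mul1r => /(mulIf tr1)/eqP.
rewrite sqrf_eq1 => /orP[]/eqP aE; first by rewrite aE scale1r.
by move: sS; rewrite sE aE scaleN1r (negPf nN).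
Qed.

Lemma stabilizer_fixed_line psi v :
  #|` S|%fset = (2 ^ n)%N ->
  (forall s, s \in S -> s psi = psi) -> psi != 0 ->
  (forall s, s \in S -> s v = v) -> v \in <[psi]>%VS.
Proof.
case: (stabS) => _ [S1 cS _] _ _ cardS fixp psi0 fixv.
have N0 : (2 ^ n)%:R != 0 :> C by rewrite pnatr_eq0 expn_eq0.
pose P : 'End(qubits) := (2 ^ n)%:R^-1 *: \sum_(s <- S) s.
have fixP u : (forall s, s \in S -> s u = u) -> P u = u.
  move=> fu; rewrite scale_lfunE sum_lfunE big_seq (eq_bigr (fun=> u)) //.
  by rewrite -big_seq big_const_seq count_predT cardS iter_addr_0 -scaler_nat
    scalerA mulVf // scale1r.
apply: (@idem_trace1_line _ _ P) (fixP _ fixp) (fixP _ fixv) psi0; last first.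
  rewrite ltraceZ ltrace_sum (big_fsetD1 \1%VF) //= ltrace1 big_seq big1 => [|s].
    by rewrite addr0 mulVf.
  by rewrite !inE => /andP[s1 sS]; rewrite stabilizer_trace.
(* Idempotence of [P]: left multiplication by [t] permutes [S], hence [t] fixes [P u], and [P] fixes
   whatever all of [S] fixes. *)
apply/lfunP => u; rewrite comp_lfunE; apply: fixP => t tS.
rewrite scale_lfunE linearZ /=; congr (_ *: _).
rewrite sum_lfunE linear_sum /=; under eq_bigr do rewrite -comp_lfunE.
rewrite -(big_map (fun s => t \o s)%VF xpredT (fun f : 'End(qubits) => f u)).
apply: perm_big; apply: uniq_perm; rewrite ?fset_uniq //.
- rewrite map_inj_uniq ?fset_uniq // => s s' /(congr1 (comp_lfun t)).
  by rewrite !comp_lfunA stabilizer_sqr // !comp_lfun1l.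
- move=> x; apply/mapP/idP => [[s sS ->]|xS]; first exact: cS.
  exists (t \o x)%VF; first exact: cS.
  by rewrite comp_lfunA stabilizer_sqr // comp_lfun1l.
Qed.

End Pauli.

(** * The span of two words as a stabilizer code *)

Section TwoDimensionalCode.

Variables (C : numClosedFieldType) (n : nat).
Local Notation qubits := (qubits C n).
Implicit Types (s t w : 'End(qubits)) (u v psi : qubits).

Variables (S : {fset 'End(qubits)}) (psi : qubits).
Hypothesis stateS : stabilizer_state S psi.

Let stabS : stabilizer_group S. Proof. by case: stateS. Qed.

Lemma stabilizer_state_neq0 : psi != 0.
Proof.
case: stateS => _ _ + _; apply: contra_eq_neq => ->.
by rewrite /inner big1 ?(eq_sym 0) ?oner_eq0 // => x _; rewrite !ffunE mulr0.
Qed.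

Lemma pauli_app_neq0 w v : is_pauli w -> v != 0 -> w v != 0.
Proof.
move=> /pauli_sqr[c c1 ww]; apply: contraNneq => wv.
have := congr1 (fun f : 'End(qubits) => f v) ww.
rewrite /= comp_lfunE wv linear0 scale_lfunE id_lfunE => /esym/eqP.
rewrite scaler_eq0; case/orP: c1 => /eqP->; last rewrite oppr_eq0.
all: by rewrite oner_eq0.
Qed.

Lemma word_eigen w s : is_pauli w -> s \in S ->
  exists2 c : C, (c == 1) || (c == -1) & s (w psi) = c *: w psi.
Proof.
case: stabS => pS _ _ _ pw sS; have [c c1 sw] := pauli_comm (pS _ sS) pw.
exists c => //; rewrite -comp_lfunE sw scale_lfunE comp_lfunE.
by case: stateS => _ _ _ fixp; rewrite (fixp s).
Qed.

(** Since [u] has the eigenvalues of [w psi], the signs cancel and [S] fixes [w u], which is then a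
    multiple of [psi]. Applying [w] once more returns [u] up to sign. *)
Lemma word_line w u : is_pauli w ->
  (forall s c, s \in S -> s (w psi) = c *: w psi -> s u = c *: u) ->
  u \in <[w psi]>%VS.
Proof.
case: stateS => _ cardS _ fixp; case: stabS => pS _ _ _ pw hu.
have : w u \in <[psi]>%VS.
  apply: (stabilizer_fixed_line stabS cardS fixp stabilizer_state_neq0) => s sS.
  have [c c1 sw] := pauli_comm (pS _ sS) pw.
  have su : s u = c *: u.
    by apply: hu => //; rewrite -comp_lfunE sw scale_lfunE comp_lfunE (fixp s).
  rewrite -comp_lfunE sw scale_lfunE comp_lfunE su linearZ scalerA.
  by case/orP: c1 => /eqP->; rewrite ?mulrNN mulr1 scale1r.
case/vlineP=> k wu; have [c c1 ww] := pauli_sqr pw.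
have : c *: u \in <[w psi]>%VS.
  rewrite -[u]id_lfunE -scale_lfunE -ww comp_lfunE wu linearZ.
  by rewrite memvZ ?memv_line.
by case/orP: c1 => /eqP->; rewrite ?scaleN1r ?memvN ?scale1r.
Qed.

Variables w0 w1 : 'End(qubits).
Hypotheses (pw0 : is_pauli w0) (pw1 : is_pauli w1).

(** The negatives are adjoined because an element of [S] with eigenvalue -1 on both words fixes both
    of them after a change of sign. *)
Definition joint_stabilizer : {fset 'End(qubits)} :=
  [fset s in (S `|` [fset - t | t in S])%fset
     | (s (w0 psi) == w0 psi) && (s (w1 psi) == w1 psi)]%fset.

Lemma joint_stabilizerP s : reflect
  [/\ s \in S \/ - s \in S, s (w0 psi) = w0 psi & s (w1 psi) = w1 psi]
  (s \in joint_stabilizer).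
Proof.
rewrite !inE /=; apply: (iffP andP) => [[sS /andP[/eqP-> /eqP->]]|[sS -> ->]].
  split=> //; case/orP: sS => [|/imfsetP[t /= tS ->]]; first by left.
  by rewrite opprK; right.
split; last by rewrite !eqxx.
case: sS => [->//|sS]; apply/orP; right; apply/imfsetP.
by exists (- s); rewrite ?opprK.
Qed.

Lemma joint_stabilizer_group : stabilizer_group joint_stabilizer.
Proof.
case: (stabS) => pS [S1 cS _] abS nN.
have sqr s : s \in joint_stabilizer -> (s \o s)%VF = \1%VF.
  case/joint_stabilizerP=> -[sS|sS] _ _; first exact: (stabilizer_sqr stabS).
  by rewrite -(stabilizer_sqr stabS sS) comp_lfunNl comp_lfunNr opprK.
split.
- move=> s /joint_stabilizerP[[/pS//|/pS ps] _ _].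
  by rewrite -[s]opprK; apply: pauliN.
- split.
  + by apply/joint_stabilizerP; rewrite !id_lfunE; split=> //; left.
  + move=> s t /joint_stabilizerP[sS s0 s1] /joint_stabilizerP[tS t0 t1].
    apply/joint_stabilizerP; rewrite !comp_lfunE t0 t1; split=> //.
    case: sS tS => sS [] tS.
    * by left; apply: cS.
    * by right; rewrite -comp_lfunNr; apply: cS.
    * by right; rewrite -comp_lfunNl; apply: cS.
    * by left; move: (cS _ _ sS tS); rewrite comp_lfunNl comp_lfunNr opprK.
  (* Each element is an involution. This gives it a trivial kernel, so that [s^-1] really cancels
     [s] and equals [s]. *)
  + move=> s sJ; have ss := sqr s sJ.
    have ks : lker s == 0%VS.
      apply/lker0P => u v uv; rewrite -[u]id_lfunE -[v]id_lfunE -ss.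
      by rewrite !comp_lfunE uv.
    by rewrite -[(s^-1)%VF]comp_lfun1r -ss lker0_compKf.
- move=> s t /joint_stabilizerP[sS _ _] /joint_stabilizerP[tS _ _].
  have NN (f g : 'End(qubits)) : (- f \o g = g \o - f -> f \o g = g \o f)%VF.
    by rewrite comp_lfunNl comp_lfunNr => /oppr_inj.
  case: sS tS => sS [] tS; first exact: abS.
  + by apply/esym/NN/abS.
  + by apply/NN/abS.
  + by apply/NN/esym/NN/abS.
(* The operator [- \1] would have to fix the nonzero vector [w0 psi]. *)
- apply/joint_stabilizerP => -[_ + _]; rewrite opp_lfunE id_lfunE => /eqP.
  rewrite eq_sym -subr_eq0 opprK -mulr2n -scaler_nat scaler_eq0 pnatr_eq0 /=.
  exact/negP/(pauli_app_neq0 pw0 stabilizer_state_neq0).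
Qed.

(* An element t of S with opposite eigenvalues a, -a on the two words cuts a
   jointly fixed vector v into eigenvectors v + a t v and v - a t v; each has
   the same eigenvalues under S as the corresponding word. *)
Lemma split_line w w' t a v : is_pauli w -> is_pauli w' -> t \in S ->
  (a == 1) || (a == -1) ->
  t (w psi) = a *: w psi -> t (w' psi) = (- a) *: w' psi ->
  (forall s c, s \in S -> (c == 1) || (c == -1) ->
    s (w psi) = c *: w psi -> s (w' psi) = c *: w' psi -> s v = c *: v) ->
  v + a *: t v \in <[w psi]>%VS.
Proof.
move=> pw pw' tS a1 tw tw' hv; apply: word_line => // s c sS sw.
case: (stabS) => pS [_ cS _] abS _.
have aa : a * a = 1 by case/orP: a1 => /eqP->; rewrite ?mulrNN mulr1.
have [c' c'1 sw2] := word_eigen pw sS.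
have wn0 := pauli_app_neq0 pw stabilizer_state_neq0.
(* The eigenvalue on the nonzero vector [w psi] is unique, so [c] is the sign supplied by
   [word_eigen]. *)
have {c'1 sw2} c1 : (c == 1) || (c == -1).
  suff <- : c' = c by [].
  by apply/eqP; rewrite -subr_eq0; have /eqP := etrans (esym sw2) sw;
    rewrite -subr_eq0 -scalerBl scaler_eq0 (negPf wn0) orbF.
have stE u : s (t u) = t (s u) by rewrite -!comp_lfunE abS.
have [e e1 sw'] := word_eigen pw' sS.
have [ec|ec] := eqVneq e c.
  rewrite ec in sw'; have sv := hv s c sS c1 sw sw'.
  by rewrite linearD linearZ /= stE sv linearZ scalerDr !scalerA mulrC.
have {}ec : e = - c.
  by move: ec; case/orP: c1 => /eqP->; case/orP: e1 => /eqP->;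
    rewrite ?opprK ?eqxx.
rewrite ec in sw'.
(* Now both [s] and [t] have opposite eigenvalues on the two words, so [s \o t] has the common
   eigenvalue [a * c] and [hv] applies to it. Hence [s] exchanges [v] and [a *: t v] up to the
   factor [c]. *)
have stv : s (t v) = (a * c) *: v.
  rewrite -comp_lfunE; apply: hv; first exact: cS.
  - by case/orP: a1 => /eqP->; case/orP: c1 => /eqP->;
      rewrite ?mulrNN ?mulr1 ?mul1r ?eqxx ?orbT.
  - by rewrite comp_lfunE tw linearZ /= sw scalerA.
  - by rewrite comp_lfunE tw' linearZ /= sw' scalerA mulrNN.
have sv : s v = (a * c) *: t v.
  have tt u : t (t u) = u.
    by rewrite -comp_lfunE (stabilizer_sqr stabS) ?id_lfunE.
  by rewrite -[s v]tt -stE stv linearZ /=.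
rewrite linearD linearZ /= stv sv scalerDr !scalerA mulrA aa mul1r addrC.
by rewrite [c * a]mulrC.
Qed.

Lemma joint_stabilizer_fixed v : w1 psi \notin <[w0 psi]>%VS ->
  (forall s, s \in joint_stabilizer -> s v = v) ->
  v \in (<[w0 psi]> + <[w1 psi]>)%VS.
Proof.
move=> w01 fixv.
(* A common eigenvalue 1 puts [s] in the joint stabilizer, a common eigenvalue -1 puts [- s]
   there. *)
have hv s c : s \in S -> (c == 1) || (c == -1) ->
    s (w0 psi) = c *: w0 psi -> s (w1 psi) = c *: w1 psi -> s v = c *: v.
  move=> sS /orP[]/eqP-> s0 s1.
    rewrite scale1r; apply/fixv/joint_stabilizerP.
    by rewrite s0 s1 !scale1r; split=> //; left.
  apply/eqP; rewrite scaleN1r -eqr_oppLR -opp_lfunE; apply/eqP.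
  apply/fixv/joint_stabilizerP; rewrite !opp_lfunE s0 s1 !scaleN1r !opprK.
  by split=> //; right.
pose differ t := (t (w0 psi) == w0 psi) != (t (w1 psi) == w1 psi).
have notN w : is_pauli w -> (- w psi == w psi) = false.
  move=> pw; apply/negbTE; rewrite eq_sym -subr_eq0 opprK -mulr2n -scaler_nat.
  by rewrite scaler_eq0 pnatr_eq0 (pauli_app_neq0 pw stabilizer_state_neq0).
(* If no element of [S] separated the words, they would have the same eigenvalues and [word_line]
   would put [w1 psi] on the line of [w0 psi]. *)
have [/hasP[t tS dt]|/hasPn same] := boolP (has differ S); last first.
  case/negP: w01; apply: word_line => // s c sS sc.
  have := same _ sS; rewrite /differ negbK.
  have [a a1 sa] := word_eigen pw0 sS; have [b b1 sb] := word_eigen pw1 sS.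
  have -> : c = a.
    apply/eqP; rewrite -subr_eq0; have /eqP := etrans (esym sc) sa.
    rewrite -subr_eq0 -scalerBl scaler_eq0 orbC.
    by rewrite (negPf (pauli_app_neq0 pw0 stabilizer_state_neq0)).
  rewrite sa sb; case/orP: a1 => /eqP->; case/orP: b1 => /eqP-> //.
    by rewrite scale1r eqxx scaleN1r notN.
  by rewrite scale1r eqxx scaleN1r notN.
have [a a1 ta] := word_eigen pw0 tS; have [b b1 tb] := word_eigen pw1 tS.
have ba : b = - a.
  move: dt; rewrite /differ ta tb.
  case/orP: a1 => /eqP->; case/orP: b1 => /eqP->;
    by rewrite ?opprK // !(scale1r, scaleN1r) !(eqxx, notN).
have v0 : v + a *: t v \in <[w0 psi]>%VS.
  by apply: (split_line pw0 pw1 tS a1 ta _ hv); rewrite -ba.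
have v1 : v + b *: t v \in <[w1 psi]>%VS.
  apply: (split_line pw1 pw0 tS b1 tb); first by rewrite ba opprK.
  by move=> s c sS c1 s1 s0; apply: hv.
(* As [b = - a], the terms in [t v] cancel and [2 v] remains. *)
have -> : v = 2^-1 *: ((v + a *: t v) + (v + b *: t v)).
  rewrite ba scaleNr addrACA subrr addr0 -mulr2n -scaler_nat scalerA.
  by rewrite mulVf ?scale1r ?pnatr_eq0.
by rewrite memvZ ?memv_add.
Qed.

Lemma word_pair_additive : w1 psi \notin <[w0 psi]>%VS ->
  additive_code (<[w0 psi]> + <[w1 psi]>)%VS.
Proof.
move=> w01; split.
  apply: contraNneq (pauli_app_neq0 pw0 stabilizer_state_neq0) => Q0.
  by rewrite -memv0 -Q0 (subvP (addvSl _ _)) ?memv_line.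
exists joint_stabilizer; first exact: joint_stabilizer_group.
move=> v; split; last exact: joint_stabilizer_fixed.
case/memv_addP=> _ /vlineP[a ->] [_ /vlineP[b ->] ->] s.
case/joint_stabilizerP=> _ s0 s1.
by rewrite linearD !linearZ /= s0 s1.
Qed.

End TwoDimensionalCode.

(** Dimension 2 provides two words on distinct lines. Their span lies in [Q] and has the same
    dimension, so [word_pair_additive] covers all of [Q]. *)
Lemma cws_dim2_additive (C : numClosedFieldType) (n : nat)
  (Q : {vspace qubits C n}) : cws_code Q -> \dim Q = 2%N -> additive_code Q.
Proof.
move=> [S [psi [K [w [stS pw _ QE]]]]] dQ.
have wn0 i : w i psi != 0.
  exact: pauli_app_neq0 (pw i) (stabilizer_state_neq0 stS).
have wQ i : w i psi \in Q.
  by rewrite QE memv_span //; apply/mapP; exists i; rewrite ?mem_enum.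
(* An empty family of words would span the zero space. *)
have [i0] : exists i0 : 'I_K, true.
  case: K w pw QE wn0 wQ => [|K] w pw QE wn0 wQ; last by exists ord0.
  by move: dQ; rewrite QE enum_ord0 span_nil dimv0.
move=> _; have [j wj] : exists j, w j psi \notin <[w i0 psi]>%VS.
  (* If every word lay on the line of [w i0 psi], the dimension of [Q] would be at most 1. *)
  apply/existsP; rewrite -negb_forall; apply/negP => /forallP all_in.
  suff /dimvS : (Q <= <[w i0 psi]>)%VS by rewrite dQ dim_vline; case: (_ != _).
  rewrite QE; apply/span_subvP => _ /mapP[j _ ->]; exact: all_in.
suff -> : Q = (<[w i0 psi]> + <[w j psi]>)%VS.
  exact: (word_pair_additive stS).
apply/esym/eqP; rewrite eqEdim subv_add -!memvE !wQ dQ /=.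
rewrite dimv_disjoint_sum ?dim_vline ?wn0 //.
apply/eqP; rewrite -subv0; apply/subvP => v; rewrite memv_cap memv0.
case/andP=> /vlineP[a ->] /vlineP[b] ab.
have [b0|b0] := eqVneq b 0; first by rewrite ab b0 scale0r.
case/negP: wj; have -> : w j psi = b^-1 *: (a *: w i0 psi).
  by rewrite ab scalerA mulVf ?scale1r.
by rewrite !memvZ ?memv_line.
Qed.

Theorem theorem6 (R : realType) (n d : nat) (hn : (1 <= n)%N) (hd : (1 <= d)%N)
  (Q : {vspace qubits R[i] n}) :
  cws_code Q -> nKd_code 2 d Q -> additive_code Q.
Proof. by move=> cQ [dQ _]; exact: cws_dim2_additive cQ dQ. Qed.
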